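(* Let $H=(V,E)$ be a hypergraph, let $w\in \mathbb{R}^E_{\geq 0}$, and let $x\in [0,1]^E$ be a fractional matching of $H$. Then there is an efficient (polynomial-time) randomized sampling procedure that returns a matching $M\subseteq E$ of $H$ satisfying \[ \Pr[e\in M] \geq \frac{x(e)}{|e|-(|e|-1)x(e)} \quad\text{for all } e\in E. \]
   Context: A hypergraph $H=(V,E)$ has a finite vertex set $V$ and edge set $E\subseteq 2^V$. A matching is a set $M\subseteq E$ of pairwise disjoint edges. For $v\in V$, $\delta(v)=\{e\in E: v\in e\}$, and for $x\in\mathbb{R}^E_{\ge 0}$ and $U\subseteq E$, $x(U)=\sum_{e\in U}x(e)$. A fractional matching is a vector $x\in\mathbb{R}^E_{\geq 0}$ with $x(\delta(v))\leq 1$ for all $v\in V$. *)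

(* Defs.v *)
From HB Require Import structures.
From mathcomp Require Import all_boot all_order all_algebra.
From mathcomp Require Import reals.

Set Implicit Arguments.
Unset Strict Implicit.
Unset Printing Implicit Defensive.

Import Order.TTheory GRing.Theory Num.Theory.
Local Open Scope ring_scope.

(** ** Hypergraphs: a finite vertex type [V] and an edge set [E : {set {set V}}].
    A vector in R^E is a function on [{set V}] of which only the values on [E]
    matter. *)

Section Hypergraph.
Variables (R : realFieldType) (V : finType) (E : {set {set V}}).

Definition delta (v : V) : {set {set V}} := [set e in E | v \in e].

Definition is_matching (M : {set {set V}}) : bool := (M \subset E) && trivIset M.

Definition fractional_matching (x : {set V} -> R) : Prop :=
  (forall e, e \in E -> 0 <= x e) /\
  (forall v, \sum_(e in delta v) x e <= 1).

End Hypergraph.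

(** ** Randomized algorithms: programs of a randomized real RAM.

    The memory consists of arrays of natural numbers and arrays of reals, both
    indexed by nat; a program names arrays by literals, hence uses only finitely
    many of them, and a scalar variable is a cell [k[0]].  Entries are addressed
    indirectly, through computed indices.

    The arithmetic is additive (no multiplication, no rounding), for naturals as
    well as for reals.  So in [t] steps the bit length of the numbers grows by
    O(t) only, and charging unit cost per step is honest: on rational inputs a
    polynomial number of steps is polynomial time in the bit model as well
    (given coins of rational bias). *)

Inductive nexp : Type :=
| NConst of nat
| NGet of nat & nexp          (* array, index *)
| NAdd of nexp & nexp
| NSub of nexp & nexp.        (* truncated *)

Inductive rexp : Type :=
| RConst of nat
| RGet of nat & nexp
| RAdd of rexp & rexp
| RSub of rexp & rexp.

Inductive bexp : Type :=
| BNlt of nexp & nexp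
| BRlt of rexp & rexp.

Inductive cmd : Type :=
| NSet of nat & nexp & nexp   (* array, index, new value *)
| RSet of nat & nexp & rexp
| If of bexp & seq cmd & seq cmd
| While of bexp & seq cmd
(* [Coin a b c1 c2] tosses a fresh independent coin of bias [a / b], and
   continues with [c1] on success and with [c2] on failure. *)
| Coin of rexp & rexp & seq cmd & seq cmd.

Definition program : Type := seq cmd.

Section Semantics.
Variable R : realFieldType.

Record memory : Type := Memory {
  nmem : nat -> nat -> nat;
  rmem : nat -> nat -> R
}.

Definition upd (T : Type) (m : nat -> nat -> T) (k i : nat) (a : T) :
    nat -> nat -> T :=
  fun k' i' => if (k' == k) && (i' == i) then a else m k' i'.

Fixpoint neval (s : memory) (a : nexp) : nat :=
  match a with
  | NConst n => n
  | NGet k i => nmem s k (neval s i)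
  | NAdd a1 a2 => (neval s a1 + neval s a2)%N
  | NSub a1 a2 => (neval s a1 - neval s a2)%N
  end.

Fixpoint reval (s : memory) (a : rexp) : R :=
  match a with
  | RConst n => n%:R
  | RGet k i => rmem s k (neval s i)
  | RAdd a1 a2 => reval s a1 + reval s a2
  | RSub a1 a2 => reval s a1 - reval s a2
  end.

Definition beval (s : memory) (b : bexp) : bool :=
  match b with
  | BNlt a1 a2 => (neval s a1 < neval s a2)%N
  | BRlt a1 a2 => reval s a1 < reval s a2
  end.

(* The ratio [a / b] is a probability only if [0 <= a <= b]; an ill-formed coin
   always fails, and so does the coin 0/0. *)
Definition bias (a b : R) : R := if 0 <= a <= b then a / b else 0.

(* The commands that remain to be executed, and the current memory. *)
Definition config : Type := (program * memory)%type.

Inductive transition : Type :=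
| Next of config
| Branch of R & config & config.   (* first configuration with probability [p],
                                      second one with probability [1 - p] *)

Definition step (c : config) : transition :=
  let s := c.2 in
  match c.1 with
  | [::] => Next c
  | NSet k i a :: rest =>
      Next (rest, Memory (upd (nmem s) k (neval s i) (neval s a)) (rmem s))
  | RSet k i a :: rest =>
      Next (rest, Memory (nmem s) (upd (rmem s) k (neval s i) (reval s a)))
  | If b c1 c2 :: rest =>
      Next ((if beval s b then c1 else c2) ++ rest, s)
  | While b c1 :: rest =>
      Next (if beval s b then c1 ++ c.1 else rest, s)
  | Coin a b c1 c2 :: rest =>
      Branch (bias (reval s a) (reval s b)) (c1 ++ rest, s) (c2 ++ rest, s)
  end.

Definition halted (c : config) : bool := nilp c.1.

(* [Pr t c Phi]: probability that the random configuration reached from [c]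
   after [t] steps satisfies [Phi] (halted configurations do not move). *)
Fixpoint Pr (t : nat) (c : config) (Phi : pred config) : R :=
  match t with
  | 0%N => (Phi c)%:R
  | t'.+1 =>
      match step c with
      | Next c' => Pr t' c' Phi
      | Branch p c1 c2 => p * Pr t' c1 Phi + (1 - p) * Pr t' c2 Phi
      end
  end.

End Semantics.

(** ** Input and output conventions. *)

Section InputOutput.
Variables (R : realFieldType) (V : finType) (E : {set {set V}}).

(* Natural array 0 holds |V| and |E|; natural array 1 holds the edge-vertex
   incidence matrix, row by row; real array 0 holds the values x(e).  All other
   cells are 0. *)
Definition input (x : {set V} -> R) : memory R :=
  Memory
    (fun k => match k with
              | 0%N => nth 0%N [:: #|V|; #|E|]
              | 1%N => nth 0%N (flatten [seq [seq nat_of_bool (v \in e) | v <- enum V]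
                                            | e : {set V} <- enum E])
              | _ => fun=> 0%N
              end)
    (fun k => match k with
              | 0%N => nth 0 [seq x e | e : {set V} <- enum E]
              | _ => fun=> 0
              end).

(* The returned edge set is read off natural array 2, as a characteristic
   vector. *)
Definition output (c : config R) : {set {set V}} :=
  [set e in E | nmem c.2 2 (index e (enum E)) != 0%N].

End InputOutput.

(* Main.v *)
Require Import Defs.
From HB Require Import structures.
From mathcomp Require Import all_boot all_order all_algebra.
From mathcomp Require Import reals.
From mathcomp Require Import zify ring lra.
(** The sampler is a weighted random greedy: as long as edges remain, draw an
    edge [c] of the remaining set [A] with probability [x c / x(A)], add it to
    the matching, and remove from [A] the edge [c] and every edge meeting it.
    For a fixed edge [e], let [N(A)] be the weight of the edges of [A] other
    than [e] that meet [e].  The quantity that is [1] once [e] is chosen,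
    [x e / (x e + N(A))] while [e] is in [A], and [0] once [e] is lost, is a
    submartingale: with [p] its value in the second case, it changes by
    [1 - p] with weight [x e], by [-p] with weight [N(A)], and does not
    decrease otherwise, while [x e * (1 - p) = N(A) * p].  It ends as the
    indicator of the event that [e] is chosen, and it starts at no less than
    the desired bound, because [N(A) <= |e| (1 - x e)] for a fractional
    matching. *)

Set Implicit Arguments.
Unset Strict Implicit.
Unset Printing Implicit Defensive.

Import Order.TTheory GRing.Theory Num.Theory.
Local Open Scope ring_scope.

(** * Success probabilities and a quantitative Hoare logic for them *)

Section ProbabilityOfReaching.
Variable R : realFieldType.
Implicit Types (c : config R) (s : memory R) (Phi : pred (config R)).

Lemma bias_ge0 (a b : R) : 0 <= bias a b.
Proof.
rewrite /bias; case: ifP => // /andP[a0 ab].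
by rewrite divr_ge0 // (le_trans a0).
Qed.

Lemma bias_le1 (a b : R) : bias a b <= 1.
Proof.
rewrite /bias; case: ifP => [/andP[a0 ab]|_]; last exact: ler01.
have [->|b0] := eqVneq b 0; first by rewrite invr0 mulr0 ler01.
by rewrite ler_pdivrMr ?mul1r // lt_neqAle eq_sym b0 (le_trans a0).
Qed.

Lemma step_bias c p c1 c2 : step c = Branch p c1 c2 -> 0 <= p <= 1.
Proof.
case: c => [[|[k i a|k i a|b d1 d2|b d|a b d1 d2] l] s] //= [<- _ _].
by rewrite bias_ge0 bias_le1.
Qed.

Lemma Pr_ge0 t c Phi : 0 <= Pr t c Phi.
Proof.
elim: t c => [|t IH] c /=; first exact: ler0n.
case E: (step c) => [c'|p c1 c2]; first exact: IH.
have /andP[p0 p1] := step_bias E.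
by rewrite addr_ge0 // mulr_ge0 // subr_ge0.
Qed.

Lemma Pr_le1 t c Phi : Pr t c Phi <= 1.
Proof.
elim: t c => [|t IH] c /=; first by case: (Phi c).
case E: (step c) => [c'|p c1 c2]; first exact: IH.
have /andP[p0 p1] := step_bias E.
have := IH c1; have := IH c2; nra.
Qed.

Lemma Pr_halted t s Phi : Pr t ([::], s) Phi = (Phi ([::], s))%:R.
Proof. by elim: t. Qed.

(** Halted configurations do not move, so a success once reached is never lost; running times can
    therefore be rounded up freely. *)
Lemma Pr_leS t c Phi : (forall d, Phi d -> halted d) ->
  Pr t c Phi <= Pr t.+1 c Phi.
Proof.
move=> Phih; elim: t c => [|t IH] c.
  rewrite [Pr 0 _ _]/=; case Phic: (Phi c); last exact: Pr_ge0.
  by have := Phih _ Phic; case: c Phic => [[|a l] s] //= ->.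
rewrite [Pr t.+1 _ _]/= [Pr t.+2 _ _]/=.
case E: (step c) => [c'|p c1 c2]; first exact: IH.
have /andP[p0 p1] := step_bias E.
by rewrite lerD // ler_wpM2l ?IH // subr_ge0.
Qed.

Lemma Pr_le_time t t' c Phi : (forall d, Phi d -> halted d) -> (t <= t')%N ->
  Pr t c Phi <= Pr t' c Phi.
Proof.
move=> Phih /subnK <-; elim: (t' - t)%N => // k IH.
by rewrite addSn (le_trans IH) // Pr_leS.
Qed.

(* A quantitative Hoare triple: if whatever follows [P] succeeds with
   probability at least [r] from every memory [s'] with [W s' r], then running
   [P] first, for at most [t] steps, succeeds with probability at least [v]. *)
Definition guarantees (P : program) (t : nat) s (v : R)
    (W : memory R -> R -> Prop) : Prop :=
  forall rest t' Phi, (forall d, Phi d -> halted d) ->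
    (forall s' r, W s' r -> r <= Pr t' (rest, s') Phi) ->
    v <= Pr (t + t') (P ++ rest, s) Phi.

Lemma guarantees_nil t s v W : W s v -> guarantees [::] t s v W.
Proof.
move=> Wsv rest t' Phi Phih H; rewrite (le_trans (H _ _ Wsv)) //=.
by rewrite Pr_le_time // leq_addl.
Qed.

(** Closes the coin branches of probability 0, to which the value 0 is assigned. *)
Lemma guarantees_le0 P t s v W : v <= 0 -> guarantees P t s v W.
Proof. by move=> v0 rest t' Phi _ _; rewrite (le_trans v0) ?Pr_ge0. Qed.

Lemma guarantees_cat t1 t2 t P Q s v W1 W : (t1 + t2 <= t)%N ->
  guarantees P t1 s v W1 ->
  (forall s' r, W1 s' r -> guarantees Q t2 s' r W) ->
  guarantees (P ++ Q) t s v W.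
Proof.
move=> tt HP HQ rest t' Phi Phih H; rewrite -catA.
have := HP (Q ++ rest) (t2 + t')%N Phi Phih.
rewrite addnA => /(_ _)/le_trans; apply; last first.
  by rewrite Pr_le_time // leq_add2r.
by move=> s' r W1s; apply: HQ.
Qed.

Lemma guarantees_nset k i a P t s v W :
  guarantees P t (Memory (upd (nmem s) k (neval s i) (neval s a)) (rmem s)) v W ->
  guarantees (NSet k i a :: P) t.+1 s v W.
Proof. by move=> H rest t' Phi Phih HW; rewrite addSn /=; apply: H. Qed.

Lemma guarantees_rset k i a P t s v W :
  guarantees P t (Memory (nmem s) (upd (rmem s) k (neval s i) (reval s a))) v W ->
  guarantees (RSet k i a :: P) t.+1 s v W.
Proof. by move=> H rest t' Phi Phih HW; rewrite addSn /=; apply: H. Qed.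

Lemma guarantees_if b d1 d2 P t s v W :
  guarantees ((if beval s b then d1 else d2) ++ P) t s v W ->
  guarantees (If b d1 d2 :: P) t.+1 s v W.
Proof.
by move=> H rest t' Phi Phih HW; rewrite addSn /= catA; apply: H.
Qed.

Lemma guarantees_coin v1 v2 a b d1 d2 P t s v W :
  let p := bias (reval s a) (reval s b) in
  v <= p * v1 + (1 - p) * v2 ->
  guarantees (d1 ++ P) t s v1 W -> guarantees (d2 ++ P) t s v2 W ->
  guarantees (Coin a b d1 d2 :: P) t.+1 s v W.
Proof.
move=> p vp H1 H2 rest t' Phi Phih HW; rewrite addSn /= -/p !catA.
apply: (le_trans vp); apply: lerD; apply: ler_wpM2l.
- exact: bias_ge0.
- exact: H1.
- by rewrite subr_ge0 bias_le1.
- exact: H2.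
Qed.

(** The value [r] belongs to the invariant because every coin changes it. An iteration is charged
    [t] plus one for its test, and the final failing test costs one more. *)
Lemma guarantees_while (I : nat -> memory R -> R -> Prop) n b B t s v :
  (forall k s r, (k < n)%N -> I k s r ->
     beval s b /\ guarantees B t s r (I k.+1)) ->
  (forall s r, I n s r -> ~~ beval s b) ->
  I 0%N s v ->
  guarantees [:: While b B] (n * t.+1).+1 s v (I n).
Proof.
move=> HB Hn I0.
suff H m k s' r : (m + k = n)%N -> I k s' r ->
    guarantees [:: While b B] (m * t.+1).+1 s' r (I n).
  by apply: H I0; rewrite addn0.
elim: m k s' r => [|m IH] k s' r mk Ik rest t' Phi Phih HW.
  rewrite add0n in mk; rewrite mk in Ik.
  by rewrite addSn /= (negbTE (Hn _ _ Ik)); apply: HW.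
have kn : (k < n)%N by lia.
have [bt HBk] := HB _ _ _ kn Ik.
have -> : ((m.+1 * t.+1).+1 + t' = (t + ((m * t.+1).+1 + t')).+1)%N by lia.
rewrite /= bt.
apply: HBk => // s'' r' Ik1.
by apply: IH Ik1 _ _ _ Phih HW; rewrite -mk addSnnS.
Qed.

Lemma guarantees_loop (I : nat -> memory R -> R -> Prop) n t1 t2 t b B P s v W :
  ((n * t1.+1).+1 + t2 <= t)%N ->
  (forall k s r, (k < n)%N -> I k s r ->
     beval s b /\ guarantees B t1 s r (I k.+1)) ->
  (forall s r, I n s r -> ~~ beval s b) ->
  I 0%N s v ->
  (forall s' r, I n s' r -> guarantees P t2 s' r W) ->
  guarantees (While b B :: P) t s v W.
Proof.
move=> tt HB Hn I0; rewrite -cat1s; apply: guarantees_cat tt _.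
exact: guarantees_while.
Qed.

End ProbabilityOfReaching.

(** * The greedy choice and its submartingale *)

Section GreedyChance.
Variables (R : realFieldType) (V : finType) (x : {set V} -> R).
Implicit Types (A M : {set {set V}}) (c e f : {set V}).

Definition survivors A c := [set f in A | (f != c) && [disjoint f & c]].

Definition conflict A e := \sum_(f in A | (f != e) && ~~ [disjoint f & e]) x f.

Definition chance e A M : R :=
  if e \in M then 1 else if e \in A then x e / (x e + conflict A e) else 0.

Lemma survivors_sub A c : survivors A c \subset A.
Proof. by apply/subsetP => f; rewrite inE => /andP[]. Qed.

Lemma card_survivors A c : c \in A -> (#|survivors A c| < #|A|)%N.
Proof.
move=> cA; apply/proper_card/properP; split; first exact: survivors_sub.
by exists c => //; rewrite inE eqxx andbF.
Qed.

Lemma conflict_ge0 A e : (forall f, f \in A -> 0 <= x f) -> 0 <= conflict A e.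
Proof. by move=> x0; apply: sumr_ge0 => f /andP[/x0]. Qed.

Lemma chance_ge0 e A M : (forall f, f \in A -> 0 <= x f) -> 0 <= chance e A M.
Proof.
move=> x0; rewrite /chance; case: ifP => // _; case: ifP => // eA.
by rewrite divr_ge0 ?addr_ge0 ?conflict_ge0 ?x0.
Qed.

Lemma le_conflict A (B : {set {set V}}) e :
  A \subset B -> (forall f, f \in B -> 0 <= x f) ->
  conflict A e <= conflict B e.
Proof.
move=> /subsetP AB x0; rewrite /conflict !big_mkcondr.
rewrite [leRHS](big_setID A) (setIidPr _) /=; last exact/subsetP.
rewrite lerDl; apply: sumr_ge0 => f; rewrite inE => /andP[_ /x0 xf].
by case: ifP.
Qed.

(** Scaling by x(A) turns probabilities into weights, so an empty [A] causes no division by zero. *)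
Lemma chance_submartingale e A M : (forall f, f \in A -> 0 < x f) ->
  (\sum_(c in A) x c) * chance e A M <=
  \sum_(c in A) x c * chance e (survivors A c) (c |: M).
Proof.
move=> x0; have xge0 f : f \in A -> 0 <= x f by move/x0/ltW.
have xS c f : f \in survivors A c -> 0 <= x f.
  by move/(subsetP (survivors_sub A c))/xge0.
have [eM|eM] := boolP (e \in M).
  rewrite {1}/chance eM mulr1 ler_sum // => c cA.
  by rewrite /chance in_setU1 eM orbT mulr1.
have [eA|eA] := boolP (e \in A); last first.
  rewrite {1}/chance (negbTE eM) (negbTE eA) mulr0 sumr_ge0 // => c cA.
  by rewrite mulr_ge0 ?xge0 ?chance_ge0 //; apply: xS.
have Dgt0 : 0 < x e + conflict A e by rewrite ltr_pwDl ?x0 ?conflict_ge0.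
set p := chance e A M.
have pE : p = x e / (x e + conflict A e) by rewrite /p /chance (negbTE eM) eA.
have p0 : 0 <= p by rewrite chance_ge0.
(* The loss caused by choosing [c]. If [c] is disjoint from [e], then [e] survives and its conflict
   can only shrink; if [c] meets [e], at most [p] is lost. *)
have step c : c \in A -> p - chance e (survivors A c) (c |: M) <=
    if c == e then p - 1 else if [disjoint c & e] then 0 else p.
  move=> cA; have [->|ce] := eqVneq c e.
    by rewrite /chance setU11.
  case: ifP => dis; last by rewrite gerBl chance_ge0 //; apply: xS.
  have eS : e \in survivors A c by rewrite inE eA eq_sym ce disjoint_sym dis.
  rewrite subr_le0 /chance in_setU1 eq_sym (negbTE ce) (negbTE eM) eS pE.
  rewrite ler_wpM2l ?xge0 // lef_pV2 ?posrE //.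
    by rewrite lerD2l le_conflict ?survivors_sub.
  by rewrite ltr_pwDl ?x0 // conflict_ge0 //; apply: xS.
rewrite mulr_suml -subr_le0 -sumrB.
under eq_bigr do rewrite -mulrBr.
apply: (le_trans (ler_sum _ (fun c cA => ler_wpM2l (xge0 c cA) (step c cA)))).
rewrite (bigD1 e) //= eqxx.
have -> : \sum_(c in A | c != e) x c *
    (if c == e then p - 1 else if [disjoint c & e] then 0 else p) =
    conflict A e * p.
  rewrite /conflict mulr_suml [RHS]big_mkcond [LHS]big_mkcond.
  apply: eq_bigr => c _.
  case: (c \in A); case: (c == e); case: [disjoint c & e] => //=.
  by rewrite mulr0.
suff -> : x e * (p - 1) + conflict A e * p = 0 by [].
by rewrite pE; field; rewrite gt_eqF.
Qed.

(** A conflicting edge shares a vertex with [e], so summing over the vertices of [e] counts it at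
    least once; at each vertex the edges other than [e] weigh at most [1 - x e]. *)
Lemma conflict_fractional_matching (E : {set {set V}}) A e :
  fractional_matching E x -> A \subset E -> e \in E ->
  conflict A e <= #|e|%:R * (1 - x e).
Proof.
move=> [x0 xd] AE eE; apply: (le_trans (le_conflict e AE x0)).
apply: (@le_trans _ _ (\sum_(v in e) \sum_(f in delta E v | f != e) x f)).
  rewrite (exchange_big_dep (fun f => (f \in E) && (f != e))) /=; last first.
    by move=> v f ve; rewrite inE -andbA => /and3P[-> _ ->].
  rewrite [leRHS]big_mkcond /conflict [leLHS]big_mkcond; apply: ler_sum => f _.
  have [fE|] //= := boolP (f \in E); case: (f =P e) => //= _.
  have sum0 (P : pred V) : 0 <= \sum_(v | P v) x f.
    by rewrite sumr_ge0 // => v _; apply: x0.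
  case: ifP => // /pred0Pn[v /andP[/= vf ve]].
  by rewrite (bigD1 v) /= ?lerDl ?sum0 // inE fE ve vf.
rewrite mulr_natl -sumr_const; apply: ler_sum => v ve.
rewrite lerBrDr; apply: le_trans (xd v).
by rewrite addrC [leRHS](bigD1 e) //= inE eE ve.
Qed.

End GreedyChance.

(** * Row-major addressing and the program *)

Lemma nth_flatten_map (T S : Type) (z : S) (y : T) (g : T -> seq S) n r i j :
  (forall a, size (g a) = n) -> (j < n)%N -> (i < size r)%N ->
  nth z (flatten [seq g a | a <- r]) (i * n + j) = nth z (g (nth y r i)) j.
Proof.
move=> szg jn; elim: r i => [|a r IH] [|i] //= ir.
  by rewrite nth_cat szg mul0n add0n jn.
rewrite nth_cat szg mulSn -addnA ltnNge leq_addr /= addKn.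
exact: IH.
Qed.

(* Natural arrays 3 to 8 hold, in cell 0, the current edge, the offset of its
   row in the incidence matrix, the chosen edge, the offset of its row, the
   current vertex and the round; cell 0 of real array 1 holds the weight of the
   edges scanned so far.  Real array 0 is overwritten: the weight of an edge
   that can no longer be chosen becomes 0. *)
Definition scalar k := NGet k (NConst 0).
Definition assign k a := NSet k (NConst 0) a.
Definition increment k := assign k (NAdd (scalar k) (NConst 1)).
Definition num_vertices := NGet 0 (NConst 0).
Definition num_edges := NGet 0 (NConst 1).

(* Reservoir sampling: replacing the chosen edge by the current one with
   probability (its weight) / (weight so far) makes the final choice
   proportional to the weights, without knowing the total in advance. *)
Definition pick_body : program :=
  [:: RSet 1 (NConst 0) (RAdd (RGet 1 (NConst 0)) (RGet 0 (scalar 3)));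
      Coin (RGet 0 (scalar 3)) (RGet 1 (NConst 0))
        [:: assign 5 (scalar 3); assign 6 (scalar 4)] [::];
      increment 3;
      assign 4 (NAdd (scalar 4) num_vertices)].

Definition scan_body : program :=
  [:: If (BNlt (NConst 1) (NAdd (NGet 1 (NAdd (scalar 6) (scalar 7)))
                                (NGet 1 (NAdd (scalar 4) (scalar 7)))))
        [:: RSet 0 (scalar 3) (RConst 0)] [::];
      increment 7].

Definition discard_body : program :=
  [:: assign 7 (NConst 0);
      While (BNlt (scalar 7) num_vertices) scan_body;
      increment 3;
      assign 4 (NAdd (scalar 4) num_vertices)].

Definition choose_edge : program :=
  [:: NSet 2 (scalar 5) (NConst 1);
      RSet 0 (scalar 5) (RConst 0);
      assign 3 (NConst 0);
      assign 4 (NConst 0);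
      While (BNlt (scalar 3) num_edges) discard_body].

Definition round_body : program :=
  [:: assign 3 (NConst 0);
      assign 4 (NConst 0);
      RSet 1 (NConst 0) (RConst 0);
      assign 5 num_edges;
      While (BNlt (scalar 3) num_edges) pick_body;
      If (BNlt (scalar 5) num_edges) choose_edge [::];
      increment 8].

Definition sampler : program :=
  [:: While (BNlt (scalar 8) num_edges) round_body].

(** * The program follows the greedy procedure *)

Section Sampler.
Variables (R : realFieldType) (V : finType) (E : {set {set V}}).
Variable x : {set V} -> R.
Implicit Types (A M : {set {set V}}) (c e f : {set V}) (s : memory R).

Local Notation eidx e := (index e (enum E)).
Local Notation vidx v := (index v (enum V)).

Lemma eidx_lt e : (eidx e < #|E|)%N = (e \in E).
Proof. by rewrite cardE index_mem mem_enum. Qed.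

Lemma vidx_lt v : (vidx v < #|V|)%N.
Proof. by rewrite cardE index_mem mem_enum. Qed.

Lemma eidx_inj e f : e \in E -> eidx e = eidx f -> e = f.
Proof.
move=> eE ef; have fE : f \in E by rewrite -eidx_lt -ef eidx_lt.
rewrite -[e](nth_index set0 (s := enum E)) ?mem_enum // ef.
by rewrite nth_index ?mem_enum.
Qed.

Lemma edge_of k : (k < #|E|)%N -> exists2 e, e \in E & eidx e = k.
Proof.
rewrite cardE => kE; exists (nth set0 (enum E) k).
  by rewrite -mem_enum mem_nth.
by rewrite index_uniq ?enum_uniq.
Qed.

Lemma vertex_of j : (j < #|V|)%N -> exists v, vidx v = j.
Proof.
move=> jV; have /card_gt0P[v0 _] := leq_ltn_trans (leq0n j) jV.
rewrite cardE in jV; exists (nth v0 (enum V) j).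
exact: index_uniq (enum_uniq V).
Qed.

(** The set [A] is not stored by itself: when [x] is positive on [A], it consists of the edges with
    nonzero weight in real array 0, and discarding an edge means zeroing its weight. *)
Record encodes s A M k : Prop := Encodes {
  enc_vertices : nmem s 0 0 = #|V|;
  enc_edges : nmem s 0 1 = #|E|;
  enc_incidence : forall e v, e \in E ->
    nmem s 1 (eidx e * #|V| + vidx v) = (v \in e) :> nat;
  enc_weight : forall e, e \in E ->
    rmem s 0 (eidx e) = if e \in A then x e else 0;
  enc_output : forall e, e \in E -> (nmem s 2 (eidx e) != 0%N) = (e \in M);
  enc_round : nmem s 8 0 = k
}.

Lemma encodes_agree s s' A M k :
  nmem s' 0 = nmem s 0 -> nmem s' 1 = nmem s 1 -> nmem s' 2 = nmem s 2 ->
  nmem s' 8 = nmem s 8 -> rmem s' 0 = rmem s 0 ->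
  encodes s A M k -> encodes s' A M k.
Proof.
move=> E0 E1 E2 E8 F0 [h1 h2 h3 h4 h5 h6].
by constructor; rewrite ?E0 ?E1 ?E2 ?E8 ?F0.
Qed.

Lemma encodes_input :
  (forall e, e \in E -> 0 <= x e) ->
  encodes (input E x) [set e in E | 0 < x e] set0 0.
Proof.
move=> x0; constructor => //=.
- move=> e v eE.
  rewrite (nth_flatten_map _ (set0 : {set V})) ?vidx_lt //.
  + rewrite nth_index ?mem_enum // (nth_map v) -?cardE ?vidx_lt //.
    by rewrite nth_index ?mem_enum.
  + by move=> a; rewrite size_map cardE.
  + by rewrite -cardE eidx_lt.
- move=> e eE; rewrite (nth_map (set0 : {set V})) -?cardE ?eidx_lt //.
  rewrite nth_index ?mem_enum // inE eE /= lt_def x0 // andbT.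
  by case: eqP.
- by move=> e eE; rewrite inE.
Qed.

(* The edges of [A] whose weight is still there while the neighbours of [c] are
   being discarded: edges before the [i]-th and vertices before the [j]-th one
   of the [i]-th edge have been inspected. *)
Definition pending A c i j := [set f in A | (f != c) &&
  [forall v in f :&: c,
     ~~ ((eidx f < i) || (eidx f == i) && (vidx v < j))%N]].

Lemma pending0 A c : pending A c 0 0 = A :\ c.
Proof.
apply/setP => f; rewrite !inE andbC; congr (_ && _).
rewrite andbC; case: (f != c); rewrite ?andbT ?andbF //.
by apply/forall_inP => v _; rewrite andbF.
Qed.

Lemma pending_next_edge A c i : pending A c i #|V| = pending A c i.+1 0.
Proof.
apply/setP => f; rewrite !inE; do 2 congr (_ && _).
apply: eq_forallb => v; congr (_ ==> _); rewrite vidx_lt andbT andbF orbF ltnS.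
by rewrite [in RHS]leq_eqVlt orbC.
Qed.

Lemma pending_last A c : A \subset E -> pending A c #|E| 0 = survivors A c.
Proof.
move=> /subsetP AE; apply/setP => f; rewrite !inE.
have [/AE fE|//] := boolP (f \in A); rewrite !andTb; congr (_ && _).
rewrite disjoints_subset; apply/forall_inP/subsetP => [H v vf|H v].
  rewrite inE; apply/negP => vc; have := H v.
  by rewrite inE vf vc eidx_lt fE => /(_ isT).
by rewrite inE => /andP[/H]; rewrite inE => /negP.
Qed.

Lemma pending_next_vertex A c e v f : e \in E -> f \in E ->
  (f \in pending A c (eidx e) (vidx v).+1) =
  (f \in pending A c (eidx e) (vidx v)) && ~~ [&& f == e, v \in e & v \in c].
Proof.
move=> eE fE; rewrite !inE -!andbA; do 2 congr (_ && _).
apply/forall_inP/andP => [H|[/forall_inP H n] u uf].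
  split; first apply/forall_inP => u uf.
    apply: contra (H u uf) => /orP[->//|/andP[-> /ltnW]].
    by rewrite orbC ltnS => ->.
  apply/negP => /and3P[/eqP fe ve vc]; have := H v.
  by rewrite inE fe ve vc eqxx leqnn orbT => /(_ isT).
have := H u uf; rewrite !negb_or => /andP[-> /=].
apply: contra => /andP[/eqP fe].
rewrite fe eqxx /= ltnS leq_eqVlt => /orP[/eqP uv|//].
have uvE : u = v.
  rewrite -[u](nth_index u (s := enum V)) ?mem_enum // uv.
  by rewrite nth_index ?mem_enum.
case/negP: n; move: uf; rewrite inE uvE.
have -> : f = e by apply: (eidx_inj fE).
by rewrite eqxx => /andP[-> ->].
Qed.

(** No coin is tossed here, so the bound by [q] is merely carried along. The invariant [I] holds
    between rows of the incidence matrix, [J] inside a row. *)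
Lemma discard_guarantees A M c k q s r : A \subset E -> c \in E ->
  encodes s A M k -> nmem s 5 0 = eidx c -> nmem s 6 0 = (eidx c * #|V|)%N ->
  r <= q ->
  guarantees choose_edge (#|E| * (4 * #|V| + 5) + 5) s r
    (fun s' r' => encodes s' (survivors A c) (c |: M) k /\ r' <= q).
Proof.
move=> AE cE enc s5 s6 rq.
rewrite (addnS _ 4) (addnS _ 3) (addnS _ 2) (addnS _ 1).
apply: guarantees_nset; apply: guarantees_rset.
do 2 apply: guarantees_nset.
pose I i s r := [/\ encodes s (pending A c i 0) (c |: M) k, nmem s 3 0 = i,
  nmem s 4 0 = (i * #|V|)%N, nmem s 6 0 = (eidx c * #|V|)%N & r <= q].
apply: (@guarantees_loop _ I #|E| (4 * #|V| + 4) 0).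
- by rewrite addn0 addn1 -(addnS (4 * #|V|)).
- move=> i {enc s5 s6 rq r}s r iE [enc s3 s4 s6 rq]; split.
    by rewrite /= s3 (enc_edges enc).
  have [e eE eidxe] := edge_of iE.
  rewrite (addnS _ 3); apply: guarantees_nset.
  pose J j s r := [/\ encodes s (pending A c i j) (c |: M) k, nmem s 3 0 = i,
    nmem s 4 0 = (i * #|V|)%N, nmem s 6 0 = (eidx c * #|V|)%N &
    nmem s 7 0 = j /\ r <= q].
  apply: (@guarantees_loop _ J #|V| 3 2).
  + lia.
  + move=> j {enc s3 s4 s6 rq r}s r jV [enc s3 s4 s6 [s7 rq]]; split.
      by rewrite /= s7 (enc_vertices enc).
    have [v vidxv] := vertex_of jV.
    (* Conjunction is not a test of the language: two incidence bits sum to more than 1 exactly when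
       both are 1. *)
    have incE : beval s (BNlt (NConst 1)
        (NAdd (NGet 1 (NAdd (scalar 6) (scalar 7)))
              (NGet 1 (NAdd (scalar 4) (scalar 7))))) = (v \in e) && (v \in c).
      rewrite /= s6 s7 s4 -vidxv -eidxe !(enc_incidence enc) //.
      by case: (v \in e); case: (v \in c).
    apply: guarantees_if; rewrite incE.
    case: ifP => [/andP[ve vc]|nve].
      apply: guarantees_rset; apply: guarantees_nset; apply: guarantees_nil.
      split=> //=; last by rewrite s7 addn1.
      case: enc => h1 h2 h3 h4 h5 h6; constructor => //= f fE.
      rewrite /upd /= s3 -eidxe -vidxv pending_next_vertex // ve vc !andbT.
      rewrite h4 // -eidxe -vidxv.
      have [->|fe] := eqVneq f e; first by rewrite eqxx andbF.
      by rewrite andbT; case: eqP => // /(eidx_inj fE)/eqP; rewrite (negbTE fe).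
    apply: guarantees_nset; apply: guarantees_nil.
    split=> //=; last by rewrite s7 addn1.
    case: enc => h1 h2 h3 h4 h5 h6; constructor => //= f fE.
    rewrite -eidxe -vidxv pending_next_vertex // nve andbF andbT.
    by rewrite h4 // -eidxe -vidxv.
  + by move=> s' r' [enc' _ _ _ [s7 _]]; rewrite /= s7 (enc_vertices enc') ltnn.
  + by split=> //=; apply: encodes_agree enc.
  + move=> {enc s3 s4 s6 rq r}s' r [enc s3 s4 s6 [s7 rq]].
    do 2 apply: guarantees_nset; apply: guarantees_nil; split=> //=.
    * by rewrite -pending_next_edge; apply: encodes_agree enc.
    * by rewrite /upd /= s3 addn1.
    * by rewrite /upd /= s4 (enc_vertices enc) mulSn addnC.
- by move=> s' r' [enc' s3 _ _ _]; rewrite /= s3 (enc_edges enc') ltnn.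
- split=> //=; rewrite pending0; case: enc => h1 h2 h3 h4 h5 h6.
  constructor => //= f fE; rewrite /upd /= s5 !inE.
    rewrite h4 //; have [->|fc] := eqVneq f c; first by rewrite eqxx.
    by case: eqP => // /(eidx_inj fE)/eqP; rewrite (negbTE fc).
  have [->|fc] := eqVneq f c; first by rewrite eqxx.
  case: (eidx f =P eidx c) => [/(eidx_inj fE)/eqP|_]; last exact: h5.
  by rewrite (negbTE fc).
- move=> s' r' [enc' _ _ _ rq']; apply: guarantees_nil.
  by rewrite -pending_last.
Qed.

Lemma sum_below_succ A e (g : {set V} -> R) : A \subset E -> e \in E ->
  \sum_(f in A | (eidx f < (eidx e).+1)%N) g f =
  \sum_(f in A | (eidx f < eidx e)%N) g f + (if e \in A then g e else 0).
Proof.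
move=> /subsetP AE eE; case: ifP => eA.
  rewrite (bigD1 e) ?eA //= addrC; congr (_ + _); apply: eq_bigl => f.
  have [/AE fE|//] := boolP (f \in A); rewrite /= ltnS [LHS]andbC ltn_neqAle.
  by congr (~~ _ && _); apply/eqP/eqP => [->//|/(eidx_inj fE)].
rewrite addr0; apply: eq_bigl => f.
have [fA|//] := boolP (f \in A); rewrite /= ltnS ltn_neqAle.
case: eqP => //= /(eidx_inj (AE _ fA)) fe.
by rewrite -fe fA in eA.
Qed.

Lemma sum_from_succ A e (g : {set V} -> R) : A \subset E -> e \in E ->
  \sum_(f in A | (eidx e <= eidx f)%N) g f =
  (if e \in A then g e else 0) + \sum_(f in A | (eidx e < eidx f)%N) g f.
Proof.
(* Once the part below [e] is added, both sides are the total over [A]. *)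
move=> AE eE; apply: (addrI (\sum_(f in A | (eidx f < eidx e)%N) g f)).
rewrite addrA -sum_below_succ //.
have split_at k : \sum_(f in A | (eidx f < k)%N) g f +
    \sum_(f in A | (k <= eidx f)%N) g f = \sum_(f in A) g f.
  rewrite [RHS](bigID (fun f => (eidx f < k)%N)) /=; congr (_ + _).
  by apply: eq_bigl => f; rewrite -leqNgt.
by rewrite !split_at.
Qed.

(** The number [#|E|], the index of no edge, encodes that nothing is chosen yet. *)
Definition chosen s A (oc : option {set V}) : Prop :=
  if oc is Some c
  then [/\ c \in A, nmem s 5 0 = eidx c & nmem s 6 0 = (eidx c * #|V|)%N]
  else nmem s 5 0 = #|E|.

(* [g c] is the value of choosing [c], and [q] that of choosing nothing, which
   happens only if [A] is empty.  Multiplying [r] by the total weight avoids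
   dividing by it. *)
Record picking A M k (g : {set V} -> R) (q : R) i s r : Prop := Picking {
  pick_encodes : encodes s A M k;
  pick_edge : nmem s 3 0 = i;
  pick_row : nmem s 4 0 = (i * #|V|)%N;
  pick_weight : rmem s 1 0 = \sum_(f in A | (eidx f < i)%N) x f;
  pick_chosen : exists oc, [/\ chosen s A oc,
    oc = None -> forall f, f \in A -> (i <= eidx f)%N,
    A = set0 -> r <= q &
    (\sum_(f in A) x f) * r <=
      (\sum_(f in A | (eidx f < i)%N) x f) * oapp g 0 oc +
      \sum_(f in A | (i <= eidx f)%N) x f * g f]
}.

(** In the inequality of [picking], the right side over x(A) is the expected final value: the
    current choice survives in proportion to the weight scanned, and each later edge wins in
    proportion to its own. The coin preserves this average. *)
Lemma pick_guarantees A M k g q i s r :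
  A \subset E -> (forall f, f \in A -> 0 < x f) -> (i < #|E|)%N ->
  picking A M k g q i s r ->
  guarantees pick_body 6 s r (picking A M k g q i.+1).
Proof.
move=> AE x0 iE [enc s3 s4 s1 [oc [ch ocN A0 rle]]].
have [e eE eidxe] := edge_of iE.
have wE := enc_weight enc eE; rewrite eidxe in wE.
set S := \sum_(f in A) x f in rle.
set T := \sum_(f in A | (eidx f < i)%N) x f in s1 rle.
have TE : \sum_(f in A | (eidx f < i.+1)%N) x f =
    T + (if e \in A then x e else 0).
  by rewrite -eidxe sum_below_succ // eidxe.
have UE : \sum_(f in A | (i <= eidx f)%N) x f * g f =
    (if e \in A then x e * g e else 0) +
    \sum_(f in A | (i < eidx f)%N) x f * g f.
  by rewrite -eidxe (sum_from_succ (fun f => x f * g f)).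
set U := \sum_(f in A | (i < eidx f)%N) x f * g f in UE.
have T0 : 0 <= T by apply: sumr_ge0 => f /andP[/x0/ltW].
have notA_next f : e \notin A -> f \in A -> (i <= eidx f)%N -> (i < eidx f)%N.
  move=> eA fA; rewrite leq_eqVlt => /orP[/eqP ef|//].
  by case/negP: eA; rewrite (@eidx_inj e f) // eidxe.
apply: guarantees_rset.
have [eA|eA] := boolP (e \in A);
  rewrite ?eA ?(negbTE eA) in wE TE UE; last first.
  (* The weight read is 0, so the coin always fails, even when it is 0/0. *)
  apply: (@guarantees_coin _ 0 r); last 1 first.
  - do 2 apply: guarantees_nset; apply: guarantees_nil; split => /=.
    + exact: encodes_agree enc.
    + by rewrite /upd /= s3 addn1.
    + by rewrite /upd /= s4 (enc_vertices enc) mulSn addnC.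
    + by rewrite /upd /= s1 s3 wE TE.
    + exists oc; split=> //; last by move: rle; rewrite TE UE addr0 add0r.
      by move=> oN f fA; apply: notA_next => //; apply: ocN.
  - by rewrite /bias /upd /= s3 wE mul0r if_same mul0r add0r subr0 mul1r.
  - exact: guarantees_le0.
have xe0 := x0 _ eA; have Te0 : 0 < T + x e by rewrite ltr_wpDl.
have S0 : 0 < S.
  by rewrite /S (bigD1 e) //= ltr_wpDr // sumr_ge0 // => f /andP[/x0/ltW].
have An0 : A <> set0 by move=> A0'; rewrite A0' inE in eA.
pose p := x e / (T + x e).
have pE : bias (x e) (T + x e) = p by rewrite /bias ltW // lerDr T0.
(* Expected final value when [c] is the choice after scanning [e]. *)
pose val c := ((T + x e) * g c + U) / S.
have done_step t s' oc' r' : chosen s' A oc' -> oc' <> None ->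
   encodes s' A M k -> nmem s' 3 0 = i -> nmem s' 4 0 = (i * #|V|)%N ->
   rmem s' 1 0 = T + x e -> S * r' <= (T + x e) * oapp g 0 oc' + U ->
   guarantees [:: increment 3; assign 4 (NAdd (scalar 4) num_vertices)]
     t.+2 s' r'
     (picking A M k g q i.+1).
  move=> ch' ocN' enc' s3' s4' s1' r'le.
  do 2 apply: guarantees_nset; apply: guarantees_nil; split => /=.
  + exact: encodes_agree enc'.
  + by rewrite /upd /= s3' addn1.
  + by rewrite /upd /= s4' (enc_vertices enc') mulSn addnC.
  + by rewrite /upd /= s1' TE.
  + by exists oc'; split=> //; rewrite TE.
apply: (@guarantees_coin _ (val e) (if oc is Some c then val c else 0)).
- rewrite /upd /= s3 wE s1 pE /val.
  have -> : r = S * r / S by rewrite mulrAC divff ?gt_eqF ?mul1r.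
  rewrite ler_pdivrMr // (le_trans rle) // UE.
  case: oc ch ocN rle => [c|] ch ocN rle /=.
    rewrite le_eqVlt; apply/orP; left; apply/eqP.
    by rewrite /p; field; rewrite !gt_eqF.
  (* Without an earlier choice no weight has been scanned, so the coin succeeds surely and the
     failure branch may get the value 0. *)
  have TN : T = 0.
    by apply: big1 => f /andP[fA]; rewrite ltnNge ocN.
  rewrite le_eqVlt; apply/orP; left; apply/eqP.
  by rewrite /p TN; field; rewrite !gt_eqF.
- do 2 apply: guarantees_nset.
  apply: (@done_step _ _ (Some e)) => //=.
  + by split=> //=; rewrite /upd /= ?s3 ?s4 eidxe.
  + exact: encodes_agree enc.
  + by rewrite /upd /= s1 s3 wE.
  + by rewrite /val mulrC divfK // gt_eqF.
- case: oc ch ocN rle => [c|] ch ocN rle; last exact: guarantees_le0.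
  apply: (@done_step _ _ (Some c)) => //=.
  + exact: encodes_agree enc.
  + by rewrite /upd /= s1 s3 wE.
  + by rewrite /val mulrC divfK // gt_eqF.
Qed.

(** Kept abstract because it is used twice: the constant 1 gives termination with a matching, and
    [chance] gives the marginals. *)
Variable phi : {set {set V}} -> {set {set V}} -> R.
Hypothesis phi_submartingale : forall A M,
  A \subset E -> (forall f, f \in A -> 0 < x f) ->
  (\sum_(c in A) x c) * phi A M <=
  \sum_(c in A) x c * phi (survivors A c) (c |: M).

(** Each choice removes at least the chosen edge, so the cardinality bound forces [A] to be empty
    after [#|E|] rounds. *)
Record greedy_state A M k : Prop := GreedyState {
  greedy_sub : A \subset E;
  greedy_pos : forall f, f \in A -> 0 < x f;
  greedy_card : (#|A| + k <= #|E|)%N;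
  greedy_matching : is_matching E M;
  greedy_disjoint : forall f g, f \in A -> g \in M -> [disjoint f & g]
}.

Lemma greedy_state_choose A M k c : c \in A -> greedy_state A M k ->
  greedy_state (survivors A c) (c |: M) k.+1.
Proof.
move=> cA [AE x0 cardA /andP[ME trivM] dis].
have /subsetP SA := survivors_sub A c.
split.
- exact: subset_trans (survivors_sub A c) AE.
- by move=> f /SA/x0.
- by have := card_survivors cA; lia.
- apply/andP; split; first by rewrite subUset sub1set (subsetP AE).
  apply/trivIsetP => f g; rewrite !in_setU1.
  case/predU1P => [->|fM] /predU1P[->|gM]; rewrite ?eqxx // => fg.
  + exact: dis.
  + by rewrite disjoint_sym dis.
  + exact: (trivIsetP trivM).
- move=> f g fS; rewrite in_setU1 => /predU1P[->|gM].
    by move: fS; rewrite inE => /and3P[].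
  by rewrite dis // SA.
Qed.

Definition running k s r := exists A M,
  [/\ encodes s A M k, greedy_state A M k & r <= phi A M].

Lemma round_guarantees k s r : (k < #|E|)%N -> running k s r ->
  guarantees round_body (#|E| * (4 * #|V| + 12) + 12) s r (running k.+1).
Proof.
move=> kE [A [M [enc st rle]]]; have [AE x0 cardA _ _] := st.
do 4 rewrite addnS.
do 2 apply: guarantees_nset; apply: guarantees_rset; apply: guarantees_nset.
pose g c := phi (survivors A c) (c |: M).
apply: (@guarantees_loop _ (picking A M k g (phi A M)) #|E| 6
          (#|E| * (4 * #|V| + 5) + 7)).
- lia.
- move=> i s' r' iE pick; split; last exact: pick_guarantees.
  by case: pick => enc' s3 _ _ _; rewrite /= s3 (enc_edges enc').
- by move=> s' r' [enc' s3 _ _ _]; rewrite /= s3 (enc_edges enc') ltnn.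
- split=> //=; first exact: encodes_agree enc.
    by rewrite big_pred0 // => f; rewrite andbF.
  exists None; split=> //=; first by rewrite /upd /= (enc_edges enc).
  rewrite mulr0 add0r [leRHS](eq_bigl (mem A)); last first.
    by move=> f; rewrite leq0n andbT.
  apply: le_trans (phi_submartingale M AE x0).
  by rewrite ler_wpM2l // sumr_ge0 // => f /x0/ltW.
move=> {enc rle r}s' r [enc _ _ _ [oc [ch ocN A0 rle]]].
rewrite addnS; apply: guarantees_if.
case: oc ch ocN rle => [c|] /= ch ocN rle.
  case: ch => cA s5 s6.
  have cE : c \in E := subsetP AE _ cA.
  rewrite s5 (enc_edges enc) eidx_lt cE.
  have S0 : 0 < \sum_(f in A) x f.
    by rewrite (bigD1 c) //= ltr_wpDr ?x0 // sumr_ge0 // => f /andP[/x0/ltW].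
  (* After the full scan the invariant reads [x(A) * r <= x(A) * g c], and x(A) is positive. *)
  have rg : r <= g c.
    move: rle; rewrite [X in _ + X]big_pred0 ?addr0; last first.
      move=> f; apply/negP => /andP[/(subsetP AE) fE].
      by rewrite leqNgt eidx_lt fE.
    have -> : \sum_(f in A | (eidx f < #|E|)%N) x f = \sum_(f in A) x f.
      by apply: eq_bigl => f; rewrite eidx_lt; apply: andb_idr => /(subsetP AE).
    by rewrite ler_pM2l.
  apply: (@guarantees_cat _ (#|E| * (4 * #|V| + 5) + 5) 1).
    by rewrite -addnA.
    exact: discard_guarantees AE cE enc s5 s6 rg.
  move=> s2 r2 [enc2 r2g]; apply: guarantees_nset; apply: guarantees_nil.
  exists (survivors A c), (c |: M); split=> //.
    by case: enc2 => *; constructor => //=; rewrite /upd /= addn1; congr _.+1.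
  exact: greedy_state_choose.
rewrite ch (enc_edges enc) ltnn addnS; apply: guarantees_nset.
apply: guarantees_nil; exists A, M.
(* No choice after the full scan would put every edge of [A] at an index of at least [#|E|]; the
   round is idle. *)
have AN : A = set0.
  apply/setP => f; rewrite inE; apply/negP => fA.
  by have := ocN erefl f fA; rewrite leqNgt eidx_lt (subsetP AE).
split; last exact: A0.
  by case: enc => *; constructor => //=; rewrite /upd /= addn1; congr _.+1.
by case: st => *; split => //; rewrite AN cards0.
Qed.

Lemma sampler_guarantees :
  (forall e, e \in E -> 0 <= x e) ->
  guarantees sampler (#|E| * (#|E| * (4 * #|V| + 12) + 13)).+1 (input E x)
    (phi [set e in E | 0 < x e] set0)
    (fun s r => exists M, [/\ is_matching E M,
       output E ([::], s) = M & r <= phi set0 M]).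
Proof.
move=> x0.
apply: (@guarantees_loop _ running #|E| (#|E| * (4 * #|V| + 12) + 12) 0).
- lia.
- move=> k s r kE run; split; last exact: round_guarantees.
  by case: run => A [M [enc _ _]]; rewrite /= (enc_edges enc) (enc_round enc).
- move=> s r [A [M [enc _ _]]].
  by rewrite /= (enc_edges enc) (enc_round enc) ltnn.
- exists [set e in E | 0 < x e], set0; split=> //; first exact: encodes_input.
  split.
  + by apply/subsetP => f; rewrite inE => /andP[].
  + by move=> f; rewrite inE => /andP[].
  + rewrite addn0; apply: subset_leq_card.
    by apply/subsetP => f; rewrite inE => /andP[].
  + by rewrite /is_matching sub0set; apply/trivIsetP => f g; rewrite inE.
  + by move=> f g _; rewrite inE.
- move=> s r [A [M [enc [AE _ cardA mM _] rle]]]; apply: guarantees_nil.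
  have A0 : A = set0 by apply/eqP; rewrite -cards_eq0; lia.
  exists M; rewrite A0 in rle; split=> //.
  apply/setP => e; rewrite inE /=; have [eE|eE] := boolP (e \in E).
    by rewrite (enc_output enc).
  by apply/esym/negbTE; apply: contra eE; case/andP: mM => /subsetP ME _ /ME.
Qed.

End Sampler.

(** * The time bound and the final estimate *)

Lemma sampler_time (n m : nat) :
  ((m * (m * (4 * n + 12) + 13)).+1 <= 30 * (n + m).+1 ^ 3)%N.
(* The constant is 4 + 12 + 13 + 1, the sum of the coefficients; each monomial is at most
   [(n + m).+1 ^ 3]. *)
Proof. rewrite !expnS expn0; nia. Qed.

(** Optional stopping: the initial value of a submartingale bounds the probability of an event whose
    indicator dominates its final value. *)
Lemma Pr_sampler_ge (R : realFieldType) (V : finType) (E : {set {set V}})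
    (x : {set V} -> R) (phi : {set {set V}} -> {set {set V}} -> R)
    (Q : {set {set V}} -> bool) :
  (forall e, e \in E -> 0 <= x e) ->
  (forall A M : {set {set V}}, A \subset E -> (forall f, f \in A -> 0 < x f) ->
     (\sum_(c in A) x c) * phi A M <=
     \sum_(c in A) x c * phi (survivors A c) (c |: M)) ->
  (forall M, is_matching E M -> phi set0 M <= (Q M)%:R) ->
  phi [set e in E | 0 < x e] set0 <=
    Pr (30 * (#|V| + #|E|).+1 ^ 3) (sampler, input E x)
       (fun c => halted c && Q (output E c)).
Proof.
move=> x0 sub phiQ.
have := sampler_guarantees sub x0 (rest := [::]) (t' := 0).
move=> /(_ (fun c => halted c && Q (output E c))) H.
rewrite cats0 addn0 in H; apply: le_trans (Pr_le_time _ _ (sampler_time _ _)).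
  apply: H => [d /andP[]//|s r [M [mM outM rle]]].
  by rewrite Pr_halted /= outM; apply: le_trans rle (phiQ _ mM).
by move=> d /andP[].
Qed.

Unset Implicit Arguments.

Theorem theorem1 (R : realType) :
  exists (P : program) (C k : nat),
    forall (V : finType) (E : {set {set V}}) (w x : {set V} -> R),
      (forall e, e \in E -> 0 <= w e) ->
      (forall e, e \in E -> 0 <= x e <= 1) ->
      fractional_matching E x ->
      let T := (C * (#|V| + #|E|).+1 ^ k)%N in
      let start : config R := (P, input E x) in
      Pr T start (fun c => halted c && is_matching E (output E c)) = 1 /\
      (forall e, e \in E ->
         Pr T start (fun c => halted c && (e \in output E c))
           >= x e / (#|e|%:R - (#|e|%:R - 1) * x e)).
Proof.
exists sampler, 30%N, 3%N => V E w x _ x01 fm T start.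
have x0 e : e \in E -> 0 <= x e by move=> /x01/andP[].
split.
  apply/le_anti; rewrite Pr_le1 /=.
  apply: (Pr_sampler_ge (phi := fun _ _ => 1)) => // [A M _ _|M ->//].
  by rewrite mulr_suml.
move=> e eE; set A := [set f in E | 0 < x f].
have AE : A \subset E by apply/subsetP => f; rewrite inE => /andP[].
apply: (@le_trans _ _ (chance x e A set0)); last first.
  apply: (Pr_sampler_ge (phi := chance x e) (Q := fun M => e \in M)) => //.
    by move=> B M _; apply: chance_submartingale.
  by move=> M _; rewrite /chance inE; case: (e \in M).
rewrite /chance inE inE eE /=.
have [xe|xe] := ltP 0 (x e); last first.
  by rewrite (le_anti (_ : x e <= 0 <= x e)) ?mul0r // xe x0.
have cge : 0 <= conflict x A e by apply: conflict_ge0 => f /(subsetP AE)/x0.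
have cle := conflict_fractional_matching fm AE eE.
(* The denominators compare because [x e + |e| * (1 - x e)] equals [|e| - (|e| - 1) * x e]. *)
rewrite ler_wpM2l ?x0 // lef_pV2 ?posrE; lra.
Qed.
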